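(* Let $n,s$ be positive integers and put $$N(n,s)=\sum_{m=1}^{n}\sum_{q=1}^{\min(m,s)}\binom{s}{q}2^{q-1}\left\{\binom{-1+\frac{m}{2}}{q-1}'+\binom{m-1}{q-1}\right\},\qquad S(n,s)=-\frac12+\sum_{q=0}^{s}2^{q-1}\binom{s}{q}\binom{n}{q}.$$ Then $N(n,s)=S(n,s)+S\!\left(\lfloor n/2\rfloor,s\right)$. Moreover, for fixed $s$, as $n\to\infty$, $S(n,s)$ is asymptotically equivalent to $-\frac12+2^{s-1}\frac{n^s}{s!}$ and $N(n,s)$ is asymptotically equivalent to $-1+\frac12(2^s+1)\frac{n^s}{s!}$.
   Context: For real $p$ and integer $q$, $\binom{p}{q}'$ denotes $\binom{p}{q}$ if $p$ and $q$ are nonnegative integers, and $0$ otherwise; $\binom{n}{q}=0$ for $q>n$. $\lfloor x\rfloor$ is the integer part. Asymptotic equivalence means the ratio tends to $1$. (Motivation: for a local ring $R$ with $2\in R^*$, $|R^*:R^{*2}|=2$, maximal ideal nilpotent of step $s$ and $R^*\cap(1+R^2)\not\subseteq R^{*2}$, this sum is known to count the classes of projectively congruent quadrics of $RP_{n-1}$.) *)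

(* Defs.v *)
From HB Require Import structures.
From mathcomp Require Import all_boot all_order all_algebra.
From mathcomp Require Import all_classical all_reals all_analysis.

Set Implicit Arguments.
Unset Strict Implicit.
Unset Printing Implicit Defensive.

Import Order.TTheory GRing.Theory Num.Theory.
Import numFieldNormedType.Exports.

Local Open Scope classical_set_scope.
Local Open Scope ring_scope.

Definition binom' (R : realType) (p : R) (q : int) : R :=
  if (p \is a Num.nat) && (0 <= q) then 'C(Num.truncn p, `|q|%N)%:R else 0.

Definition quadN (R : realType) (n s : nat) : R :=
  \sum_(1 <= m < n.+1) \sum_(1 <= q < (minn m s).+1)
    'C(s, q)%:R * 2 ^+ (q - 1) *
      (binom' (-1 + m%:R / 2 : R) (q%:Z - 1) + 'C(m - 1, q - 1)%:R).

(* The power of 2 is an integer power: its exponent is -1 at q = 0. *)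
Definition quadS (R : realType) (n s : nat) : R :=
  - (1 / 2) + \sum_(0 <= q < s.+1)
    (2 : R) ^ (q%:Z - 1) * 'C(s, q)%:R * 'C(n, q)%:R.

Definition asymp_equiv (R : realType) (u v : nat -> R) : Prop :=
  u n / v n @[n --> \oo] --> (1 : R).

(* Main.v *)
Require Import Defs.
From HB Require Import structures.
From mathcomp Require Import all_boot all_order all_algebra.
From mathcomp Require Import all_classical all_reals all_analysis.
From mathcomp Require Import zify ring lra.

Import Order.TTheory GRing.Theory Num.Theory.
Import numFieldNormedType.Exports.

Local Open Scope classical_set_scope.
Local Open Scope ring_scope.

(* By Pascal's rule the bracket at (m, q) is the increment from m - 1 to m of
   'C(m, q) + 'C(m %/ 2, q): for odd m the floor m %/ 2 does not move and the
   primed binomial vanishes.  So the inner sum is the increment of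
   S(m, s) + S(m %/ 2, s), and the sum over m telescopes.  For the asymptotics,
   if u n / n tends to c then 'C(u n, q) / n ^ q tends to c ^ q / q!, so only
   the term q = s of S(u n, s) / n ^ s survives; apply this with u n = n and
   u n = n %/ 2. *)

(** If [m.+1 = 2 * (j + 1)], the argument of [binom'] is the natural number [j] and the claim is
    Pascal's rule; otherwise both sides are 0. *)
Lemma binom'_half_pred (R : realType) (m q : nat) :
  binom' (-1 + m.+1%:R / 2 : R) (q.+1%:Z - 1) =
  'C(m.+1 %/ 2, q.+1)%:R - 'C(m %/ 2, q.+1)%:R.
Proof.
have -> : (q.+1%:Z - 1) = q%:Z by lia.
rewrite /binom' lez_nat leq0n andbT; case: ifPn => [/natrP[j]|] hp.
  have e : (m.+1 = (j.+1).*2)%N.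
    apply/eqP; rewrite -(eqr_nat R) -muln2 natrM -[j.+1]addn1 natrD -hp.
    by apply/eqP; field.
  rewrite hp natrK.
  have -> : (m.+1 %/ 2)%N = j.+1 by lia.
  have -> : (m %/ 2)%N = j by lia.
  by rewrite /= binS natrD addrC addKr.
have [mo|me] := boolP (odd m); last first.
  by have -> : (m.+1 %/ 2 = m %/ 2)%N; [lia | rewrite subrr].
(* Odd [m] contradicts [hp]: then [m.+1] is even and the argument equals [m %/ 2]. *)
case/negP: hp; apply/natrP; exists (m %/ 2)%N.
have {1}-> : m.+1 = ((m %/ 2).+1 * 2)%N by lia.
by rewrite natrM -[(m %/ 2).+1]addn1 natrD; field.
Qed.

(** The [q = 0] term is [2 ^ (-1)], which cancels the constant [- (1 / 2)]; shifting the index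
    leaves only natural exponents. *)
Lemma quadSE (R : realType) (n s : nat) :
  quadS R n s = \sum_(0 <= q < s) 2 ^+ q * 'C(s, q.+1)%:R * 'C(n, q.+1)%:R.
Proof.
rewrite /quadS big_nat_recl //= !bin0 !mulr1.
have -> : (2 : R) ^ (0%:Z - 1) = 1 / 2 by rewrite add0r div1r.
rewrite addKr; apply: eq_bigr => q _.
by have -> : (q.+1%:Z - 1) = q%:Z by lia.
Qed.

Lemma quadN_step (R : realType) (m s : nat) :
  \sum_(1 <= q < (minn m.+1 s).+1) 'C(s, q)%:R * 2 ^+ (q - 1) *
     (binom' (-1 + m.+1%:R / 2 : R) (q%:Z - 1) + 'C(m.+1 - 1, q - 1)%:R) =
  (quadS R m.+1 s + quadS R (m.+1 %/ 2) s) - (quadS R m s + quadS R (m %/ 2) s).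
Proof.
pose G q : R := 2 ^+ q * 'C(s, q.+1)%:R *
  ('C(m.+1, q.+1)%:R + 'C(m.+1 %/ 2, q.+1)%:R
   - ('C(m, q.+1)%:R + 'C(m %/ 2, q.+1)%:R)).
rewrite big_add1 /=; transitivity (\sum_(0 <= q < minn m.+1 s) G q).
  apply: eq_bigr => q _; rewrite binom'_half_pred !subn1 /= /G binS natrD.
  by ring.
transitivity (\sum_(0 <= q < s) G q); last first.
  rewrite !quadSE -!big_split /= -sumrB; apply: eq_bigr => q _.
  by rewrite /G mulrBr !mulrDr.
(* The cap [minn m.+1 s] can be raised to [s]: an added index has [q >= m.+1], so all four binomials
   in [G q] vanish. *)
rewrite [RHS](big_cat_nat (n := minn m.+1 s)) //=; last by lia.
rewrite [X in _ + X]big1_seq ?addr0 // => q /andP[_].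
rewrite mem_index_iota => hq.
have C0 k : (k <= m.+1)%N -> 'C(k, q.+1) = 0%N by move=> ?; apply: bin_small; lia.
rewrite /G (C0 m.+1) ?(C0 m) ?(C0 (m.+1 %/ 2)%N) ?(C0 (m %/ 2)%N); try lia.
by rewrite subrr mulr0.
Qed.

Lemma quadN_eq (R : realType) (n s : nat) :
  quadN R n s = quadS R n s + quadS R (n %/ 2) s.
Proof.
have S0 : quadS R 0 s = 0 by rewrite quadSE big1 // => q _; rewrite bin0n mulr0.
rewrite /quadN big_add1 /=.
rewrite (telescope_sumr_eq (fun m => quadS R m s + quadS R (m %/ 2) s)) //.
  by rewrite div0n S0 addr0 subr0.
by move=> m _; rewrite quadN_step.
Qed.

Lemma cvg_invn (R : realType) : n%:R^-1 @[n --> \oo] --> (0 : R).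
Proof. by rewrite -cvg_shiftS; exact: cvg_harmonic. Qed.

Lemma cvg_expr (R : realType) (u : nat -> R) (l : R) (k : nat) :
  u n @[n --> \oo] --> l -> u n ^+ k @[n --> \oo] --> l ^+ k.
Proof.
move=> ul; elim: k => [|k IHk]; first by rewrite expr0; exact: cvg_cst.
rewrite exprS; under eq_fun do rewrite exprS; exact: cvgM.
Qed.

Lemma cvg_half_divn (R : realType) :
  (n %/ 2)%:R / n%:R @[n --> \oo] --> (1 / 2 : R).
Proof.
(* Since [n <= n %/ 2 * 2 + 1], the ratio is at least 1/2 - 1/(2n); the cruder bound 1/2 - 1/n
   suffices. *)
apply: (@squeeze_cvgr _ _ _ _ (fun n => 1 / 2 - n%:R^-1) (fun=> 1 / 2));
  [|by rewrite -[X in _ --> X]subr0; apply: cvgB; [exact: cvg_cst|exact: cvg_invn]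
   |exact: cvg_cst].
near=> n.
have n0 : 0 < n%:R :> R by rewrite ltr0n; near: n; exact: nbhs_infty_gt.
rewrite ler_pdivlMr // ler_pdivrMr // mulrBl mulVf ?gt_eqF //.
have : (n <= n %/ 2 * 2 + 1)%N by lia.
have : (n %/ 2 * 2 <= n)%N by lia.
by rewrite -!(ler_nat R) natrD natrM => h1 h2; apply/andP; split; lra.
Unshelve. all: by end_near. Qed.

Section BinomialGrowth.
Variables (R : realType) (u : nat -> nat) (c : R).
Hypothesis uc : (u n)%:R / n%:R @[n --> \oo] --> c.

(** The falling factorial has [q] factors [u n - i] with [i] fixed, and each of them divided by [n]
    tends to [c]. *)
Lemma cvg_ffact_ratio (q : nat) :
  (u n ^_ q)%:R / n%:R ^+ q @[n --> \oo] --> c ^+ q.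
Proof.
elim: q => [|q IHq].
  under eq_fun do rewrite ffactn0 expr0 divr1; exact: cvg_cst.
have -> : (fun n => (u n ^_ q.+1)%:R / n%:R ^+ q.+1) =
    (fun n => ((u n ^_ q)%:R / n%:R ^+ q) *
              ((u n)%:R / n%:R - q%:R * n%:R^-1)) :> (nat -> R).
  apply/funext => n; rewrite exprSr invfM ffactnSr natrM.
  (* Truncated subtraction is harmless: the factor u n ^_ q is 0 there. *)
  have [uq|qu] := ltnP (u n) q; first by rewrite ffact_small // !mul0r.
  by rewrite natrB //; ring.
have -> : c ^+ q.+1 = c ^+ q * (c - q%:R * 0) by rewrite exprSr mulr0 subr0.
apply: cvgM => //; apply: cvgB => //.
by apply: cvgM; [exact: cvg_cst | exact: cvg_invn].
Qed.

Lemma cvg_bin_ratio (q : nat) :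
  'C(u n, q)%:R / n%:R ^+ q @[n --> \oo] --> c ^+ q / q`!%:R.
Proof.
have f0 : q`!%:R != 0 :> R by rewrite pnatr_eq0 -lt0n fact_gt0.
have -> : (fun n => 'C(u n, q)%:R / n%:R ^+ q) =
    (fun n => (u n ^_ q)%:R / n%:R ^+ q * q`!%:R^-1) :> (nat -> R).
  by apply/funext => n; rewrite -bin_ffact natrM mulrAC mulfK.
by apply: cvgM; [exact: cvg_ffact_ratio | exact: cvg_cst].
Qed.

(** The surplus factor [n%:R^-1 ^+ (s - q)] has a positive exponent and tends to 0, while the rest
    stays convergent. *)
Lemma cvg_bin_ratio_lt (q s : nat) : (q < s)%N ->
  'C(u n, q)%:R / n%:R ^+ s @[n --> \oo] --> (0 : R).
Proof.
move=> qs.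
have -> : (fun n => 'C(u n, q)%:R / n%:R ^+ s) =
    (fun n => 'C(u n, q)%:R / n%:R ^+ q * n%:R^-1 ^+ (s - q)) :> (nat -> R).
  by apply/funext => n; rewrite -{1}(subnKC (ltnW qs)) exprD invfM mulrA exprVn.
have z : (0 : R) = c ^+ q / q`!%:R * 0 ^+ (s - q).
  by rewrite expr0n subn_eq0 leqNgt qs mulr0.
rewrite [X in _ --> X]z; apply: cvgM; first exact: cvg_bin_ratio.
by apply: cvg_expr; exact: cvg_invn.
Qed.

Lemma cvg_quadS_ratio (s : nat) :
  quadS R (u n) s.+1 / n%:R ^+ s.+1 @[n --> \oo] -->
  2 ^+ s * (c ^+ s.+1 / s.+1`!%:R).
Proof.
have -> : (fun n => quadS R (u n) s.+1 / n%:R ^+ s.+1) =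
    (fun n => \sum_(q < s) 2 ^+ q * 'C(s.+1, q.+1)%:R *
                ('C(u n, q.+1)%:R / n%:R ^+ s.+1) +
              2 ^+ s * ('C(u n, s.+1)%:R / n%:R ^+ s.+1)) :> (nat -> R).
  apply/funext => n; rewrite quadSE big_mkord big_ord_recr /= mulrDl binn mulr1 mulrA.
  by congr (_ + _); rewrite mulr_suml; apply: eq_bigr => q _; rewrite mulrA.
rewrite -[X in _ --> X]add0r; apply: cvgD; last first.
  by apply: cvgM; [exact: cvg_cst | exact: cvg_bin_ratio].
have z : (0 : R) = \sum_(q < s) 0 by rewrite big1.
rewrite [X in _ --> X]z; apply: cvg_big => [|q _]; first exact: add_continuous.
rewrite -[X in _ --> X](mulr0 (2 ^+ q * 'C(s.+1, q.+1)%:R)).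
by apply: cvgM; [exact: cvg_cst | apply: cvg_bin_ratio_lt; rewrite ltnS].
Qed.

End BinomialGrowth.

(** Dividing both functions by [n ^ s] gives two quotients with the same nonzero limit [b], as
    [a / n ^ s] tends to 0 for positive [s]. *)
Lemma asymp_equiv_monomial (R : realType) (f : nat -> R) (a b : R) (s : nat) :
  (0 < s)%N -> b != 0 -> f n / n%:R ^+ s @[n --> \oo] --> b ->
  asymp_equiv f (fun n => a + b * n%:R ^+ s).
Proof.
move=> s0 b0 fb; rewrite /asymp_equiv.
have gb : a * n%:R^-1 ^+ s + b @[n --> \oo] --> b.
  rewrite -[X in _ --> X]add0r; apply: cvgD; last exact: cvg_cst.
  rewrite -[X in _ --> X](mulr0 a); apply: cvgM; first exact: cvg_cst.
  have <- : (0 : R) ^+ s = 0 by rewrite expr0n -[s == _]negbK -lt0n s0.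
  by apply: cvg_expr; exact: cvg_invn.
rewrite -[X in _ --> X](divff b0).
(* Cancelling [n ^ s] requires [n > 0], hence an eventual equality. *)
apply: cvg_trans (cvgM fb (cvgV b0 gb)); apply: near_eq_cvg; near=> n.
have n0 : n%:R ^+ s != 0 :> R.
  by rewrite expf_neq0 // pnatr_eq0 -lt0n; near: n; exact: nbhs_infty_gt.
have -> : a + b * n%:R ^+ s = (a * n%:R^-1 ^+ s + b) * n%:R ^+ s.
  by rewrite mulrDl exprVn mulfVK.
by rewrite /= [in RHS]invfM mulrCA mulrC.
Unshelve. all: by end_near. Qed.

Theorem theorem2 (R : realType) (s : nat) (hs : (0 < s)%N) :
  (forall n : nat, (0 < n)%N ->
     quadN R n s = quadS R n s + quadS R (n %/ 2)%N s) /\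
  asymp_equiv (fun n : nat => quadS R n s)
    (fun n : nat => - (1 / 2) + (2 : R) ^+ (s - 1) * (n%:R ^+ s / s`!%:R)) /\
  asymp_equiv (fun n : nat => quadN R n s)
    (fun n : nat => -1 + 1 / 2 * ((2 : R) ^+ s + 1) * (n%:R ^+ s / s`!%:R)).
Proof.
split=> [n _|]; first exact: quadN_eq.
case: s hs => [//|s] _; rewrite subn1 /=.
have f0 : 0 < s.+1`!%:R :> R by rewrite ltr0n fact_gt0.
have Sid : quadS R n s.+1 / n%:R ^+ s.+1 @[n --> \oo] -->
    (2 ^+ s / s.+1`!%:R : R).
  have id1 : n%:R / n%:R @[n --> \oo] --> (1 : R).
    apply: cvg_near_cst; near=> n; rewrite divff // pnatr_eq0 -lt0n.
    by near: n; exact: nbhs_infty_gt.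
  by have := cvg_quadS_ratio R id _ id1 s; rewrite expr1n div1r.
split.
  have -> : (fun n => - (1 / 2) + (2 : R) ^+ s * (n%:R ^+ s.+1 / s.+1`!%:R)) =
      (fun n => - (1 / 2) + 2 ^+ s / s.+1`!%:R * n%:R ^+ s.+1).
    by apply/funext => n; rewrite mulrA mulrAC.
  by apply: asymp_equiv_monomial => //; rewrite gt_eqF // divr_gt0 ?exprn_gt0.
pose b : R := 1 / 2 * (2 ^+ s.+1 + 1) / s.+1`!%:R.
have -> : (fun n => -1 + 1 / 2 * ((2 : R) ^+ s.+1 + 1) *
                      (n%:R ^+ s.+1 / s.+1`!%:R)) =
    (fun n => -1 + b * n%:R ^+ s.+1).
  by apply/funext => n; rewrite mulrA mulrAC.
apply: asymp_equiv_monomial => //.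
  by rewrite gt_eqF // divr_gt0 // mulr_gt0 ?addr_gt0 ?exprn_gt0 // divr_gt0.
under eq_fun do rewrite quadN_eq mulrDl.
(* The two summands are the limits from [cvg_quadS_ratio] for [c = 1] and [c = 1 / 2], one for each
   half of [quadN_eq]. *)
have -> : b = 2 ^+ s / s.+1`!%:R + 2 ^+ s * ((1 / 2) ^+ s.+1 / s.+1`!%:R).
  rewrite /b expr_div_n expr1n exprS.
  by field; rewrite gt_eqF // expf_neq0.
by apply: cvgD => //; apply: cvg_quadS_ratio; exact: cvg_half_divn.
Unshelve. all: by end_near. Qed.
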